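(* For a partition $\lambda$ with at most $n$ parts, \[ g_\lambda(x_1,\dots,x_n;\boldsymbol\alpha,\boldsymbol\beta)=\det\Big(h_{\lambda_i-i+j}\big[X_n-A_{\lambda_i-1}+B_{i-1}-B_{j-1}\big]\Big)_{i,j=1}^n. \]
   Context: $A_k=\alpha_1+\dots+\alpha_k$, $B_k=\beta_1+\dots+\beta_k$ for $k\ge1$, $A_k=B_k=0$ for $k\le0$; $X_n=x_1+\dots+x_n$. For a formal $\mathbb Z$-linear combination $Z=\sum_uc_uu$ of variables/parameters, $\sum_{m\ge0}h_m[Z]t^m=\prod_u(1-ut)^{-c_u}$, $h_m[Z]=0$ for $m<0$. $g_\lambda(x_1,\dots,x_n;\boldsymbol\alpha,\boldsymbol\beta)=\det(h_{\lambda_i+n-i}[x_j-A_{\lambda_i-1}+B_{i-1}])_{i,j=1}^n/\prod_{1\le i<j\le n}(x_i-x_j)$. *)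

(* Defs.v *)
(* MathComp, with multinomials for multivariate polynomials and free abelian
   groups. *)
From HB Require Import structures.
From mathcomp Require Import all_boot all_order all_algebra.
From mathcomp Require Import freeg mpoly.

Set Implicit Arguments.
Unset Strict Implicit.
Unset Printing Implicit Defensive.

Import GRing.Theory.

Local Open Scope ring_scope.

Notation "x %:F" := (@FracField.tofrac _ x) : ring_scope.

Section Plethysm.

Context (S : comNzRingType).

(* A formal power series in t is the sequence of its coefficients. *)
Definition series := nat -> S.

Definition series_one : series := fun m => (m == 0)%:R.

Definition series_mul (f g : series) : series :=
  fun m => \sum_(i < m.+1) f i * g (m - i)%N.

Definition series_exp (f : series) (k : nat) : series :=
  iter k (series_mul f) series_one.

(* 1 - u t *)
Definition series_lin (u : S) : series :=
  fun m => match m with 0 => 1 | 1 => - u | _ => 0 end.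

(* (1 - u t)^(-1), see series_linK *)
Definition series_geom (u : S) : series := fun m => u ^+ m.

Lemma series_linK (u : S) :
  series_mul (series_lin u) (series_geom u) =1 series_one.
Proof.
case=> [|m]; first by rewrite /series_mul big_ord1 mul1r.
rewrite /series_mul !big_ord_recl big1 => [|i _]; last by rewrite mul0r.
by rewrite /= addr0 mul1r /series_geom subSS !subn0 mulNr -exprS subrr.
Qed.

(* (1 - u t)^(-c) *)
Definition series_factor (u : S) (c : int) : series :=
  match c with
  | Posz k => series_exp (series_geom u) k
  | Negz k => series_exp (series_lin u) k.+1
  end.

(* The product over u of (1 - u t)^(-c_u), for Z = sum_u c_u u.  Here
   {freeg S} is the free abelian group on the elements of S, so that << u >>
   is the letter u, and << u >> + << v >> is not << u + v >>. *)
Definition hseries (Z : {freeg S}) : series :=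
  \big[series_mul/series_one]_(u <- dom Z) series_factor u (coeff u Z).

(* h_m[Z] *)
Definition hpleth (m : int) (Z : {freeg S}) : S :=
  match m with Posz k => hseries Z k | Negz _ => 0 end.

(* a_1 + ... + a_k as a formal sum, empty when k <= 0; a 0 is never used. *)
Definition alphabet (a : nat -> S) (k : int) : {freeg S} :=
  match k with
  | Posz p => \sum_(1 <= i < p.+1) << a i >>
  | Negz _ => 0
  end.

End Plethysm.

Definition is_partition (lam : seq nat) : bool :=
  sorted geq lam && (0%N \notin lam).

Section DualGrothendieck.

(* The x_j are the indeterminates of {mpoly R[n]}; the parameters alpha_k and
   beta_k (k >= 1) are arbitrary elements of the coefficient ring, which may
   itself be a polynomial ring in the parameters. *)
Context (R : idomainType) (n : nat) (alpha beta : nat -> R).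

Definition A (k : int) : {freeg {mpoly R[n]}} :=
  alphabet (fun i => (alpha i)%:MP) k.

Definition B (k : int) : {freeg {mpoly R[n]}} :=
  alphabet (fun i => (beta i)%:MP) k.

Definition X : {freeg {mpoly R[n]}} := \sum_(j < n) << 'X_j >>.

(* lambda_(i+1): rows and columns are numbered from 0 by 'I_n, so an index i
   of the text is i.+1 here (and the text's i - 1 is i). *)
Definition part (lam : seq nat) (i : 'I_n) : int := (nth 0%N lam i)%:Z.

Definition vandermonde : {mpoly R[n]} :=
  \prod_(i < n) \prod_(j < n | (i < j)%N) ('X_i - 'X_j).

Definition bialternant (lam : seq nat) : {mpoly R[n]} :=
  \det (\matrix_(i < n, j < n)
    hpleth (part lam i + n%:Z - i.+1%:Z)
           (<< 'X_j >> - A (part lam i - 1) + B i%:Z)).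

(* The quotient is taken in the field of rational functions in x_1, ..., x_n. *)
Definition g (lam : seq nat) : {fraction {mpoly R[n]}} :=
  (bialternant lam)%:F / vandermonde%:F.

End DualGrothendieck.

(* Main.v *)
(** The coefficients of H[Z](t) satisfy h_m[Z - b] = h_m[Z] - b h_(m-1)[Z], so
    the linear functional t^d |-> h_(s+d)[Z] sends a monic polynomial with roots
    b_1, ..., b_k to h_(s+k)[Z - b_1 - ... - b_k].  Apply it to the expansion of
    prod_(l <> j) (t - x_l) in the Newton basis prod_(l <= k) (t - beta_l),
    k < n: row by row, the matrix of the bialternant is the Jacobi-Trudi matrix
    times the matrix P of Newton coordinates.  Evaluating the expansions at
    x_1, ..., x_n shows that det P is the Vandermonde product. *)
Require Import Defs.
From Stdlib Require Import FunctionalExtensionality.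
From HB Require Import structures.
From mathcomp Require Import all_boot all_order all_algebra.
From mathcomp Require Import ring freeg mpoly.

Set Implicit Arguments.
Unset Strict Implicit.
Unset Printing Implicit Defensive.

Import GRing.Theory.

Local Open Scope ring_scope.

(** * Generating series of formal alphabets and removal of a letter *)

Section Series.

Context (S : comNzRingType).
Implicit Types (f g h : series S) (u : S) (Z : {freeg S}).

(** The coefficient of t^m sees only coefficients of index at most m, so the laws of the series
    product follow from those of truncated polynomials. *)
Lemma series_mulE f g N m : (m < N)%N ->
  series_mul f g m = ((\poly_(i < N) f i) * (\poly_(i < N) g i))`_m.
Proof.
move=> ltmN; rewrite coefM; apply: eq_bigr => i _.
rewrite !coef_poly (leq_ltn_trans (leq_subr _ _) ltmN).
by rewrite (leq_ltn_trans _ ltmN) // -ltnS.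
Qed.

Lemma series_mulC : commutative (@series_mul S).
Proof.
move=> f g; apply: functional_extensionality => m.
by rewrite !(series_mulE _ _ (ltnSn m)) mulrC.
Qed.

Lemma series_mulA : associative (@series_mul S).
Proof.
move=> f g h; apply: functional_extensionality => m.
pose T f := \poly_(i < m.+1) f i.
transitivity (T f * (T g * T h))`_m.
  rewrite coefM; apply: eq_bigr => i _; rewrite coef_poly ltn_ord.
  by rewrite -series_mulE // ltnS leq_subr.
rewrite mulrA coefM; apply: eq_bigr => i _.
by rewrite coef_poly ltnS leq_subr -series_mulE.
Qed.

Lemma series_mul1 : left_id (@series_one S) (@series_mul S).
Proof.
move=> f; apply: functional_extensionality => m.
rewrite /series_mul big_ord_recl subn0 mul1r big1 ?addr0 // => i _.
by rewrite mul0r.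
Qed.

HB.instance Definition _ := Monoid.isComLaw.Build (series S)
  (@series_one S) (@series_mul S) series_mulA series_mulC series_mul1.

Lemma series_linE u f m :
  series_mul (series_lin u) f m = f m - (if m is k.+1 then u * f k else 0).
Proof.
case: m => [|m]; first by rewrite /series_mul big_ord1 mul1r subr0.
rewrite /series_mul !big_ord_recl big1 => [|i _]; last by rewrite mul0r.
by rewrite /= addr0 mul1r mulNr subSS !subn0.
Qed.

Lemma series_factorB1 u (c : int) :
  series_factor u (c - 1) = series_mul (series_lin u) (series_factor u c).
Proof.
case: c => [[|k]|k] //=.
- rewrite series_mulA (functional_extensionality _ _ (series_linK u)).
  by rewrite series_mul1 subn1.
- by rewrite addn0.
Qed.

(** Letters outside [dom Z] have exponent 0 and contribute the factor 1. Two alphabets can thus be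
    compared over one common list. *)
Lemma hseriesE Z (r : seq S) : uniq r -> {subset dom Z <= r} ->
  hseries Z = \big[@series_mul S/@series_one S]_(u <- r) series_factor u (coeff u Z).
Proof.
move=> Ur sZr; rewrite (bigID (mem (dom Z))) /= [X in series_mul _ X]big1.
  rewrite [RHS]Monoid.mulm1 -big_filter; apply: perm_big.
  apply: uniq_perm; rewrite ?uniq_dom ?filter_uniq // => u.
  by rewrite mem_filter andb_idr //; exact: sZr.
by move=> u /coeff_outdom ->.
Qed.

Lemma hseriesB1 Z u :
  hseries (Z - << u >>) = series_mul (series_lin u) (hseries Z).
Proof.
(* A common list of letters containing [u], whose factor is the only one that changes. *)
pose r := undup (u :: dom Z ++ dom (Z - << u >>)).
have Ur : uniq r by exact: undup_uniq.
have ur : u \in r by rewrite mem_undup mem_head.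
rewrite !(@hseriesE _ r) // => [|v Zv|v Zv]; last first.
- by rewrite mem_undup inE mem_cat Zv !orbT.
- by rewrite mem_undup inE mem_cat Zv !orbT.
rewrite !(bigD1_seq u ur Ur) /= series_mulA -series_factorB1.
rewrite coeffB coeffU eqxx mulr1; congr series_mul.
apply: eq_bigr => v neq_vu.
by rewrite coeffB coeffU eq_sym (negbTE neq_vu) mulr0 subr0.
Qed.

Lemma hplethB1 (m : int) Z u :
  hpleth m (Z - << u >>) = hpleth m Z - u * hpleth (m - 1) Z.
Proof.
case: m => [[|m]|m].
- by rewrite /= hseriesB1 series_linE mulr0.
- have -> : m.+1%:Z - 1 = m%:Z by rewrite -(addn1 m) PoszD addrK.
  by rewrite /= hseriesB1 series_linE.
- by rewrite NegzE -opprD -PoszD addn1 -!NegzE /= mulr0 subr0.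
Qed.

(* Replacing t^d by h_{s+d}[Z] turns the factor t - b into the removal of the
   letter b from Z. *)
Lemma hpleth_umbral (bs : seq S) (s : int) Z (N : nat) : (size bs < N)%N ->
  \sum_(d < N) (\prod_(b <- bs) ('X - b%:P))`_d * hpleth (s + d%:Z) Z =
  hpleth (s + (size bs)%:Z) (Z - \sum_(b <- bs) << b >>).
Proof.
elim: bs s Z N => [|b bs IH] s Z [|N] //=.
  move=> _; rewrite !big_nil oppr0 !addr0 big_ord_recl big1 => [|i _].
    by rewrite coef1 mul1r !addr0.
  by rewrite coef1 mul0r.
rewrite ltnS => ltN; rewrite !big_cons opprD addrA.
have -> : s + (size bs).+1%:Z = (s + 1) + (size bs)%:Z.
  by rewrite -addrA -PoszD add1n.
rewrite -(IH _ _ _ ltN); set p := \prod_(_ <- bs) _.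
have pN : p`_N = 0.
  by apply: nth_default; rewrite size_prod_XsubC.
transitivity (\sum_(d < N.+1) ('X * p)`_d * hpleth (s + d%:Z) Z
              - \sum_(d < N.+1) b * p`_d * hpleth (s + d%:Z) Z).
  rewrite -sumrB; apply: eq_bigr => d _.
  by rewrite mulrBl coefB coefCM mulrBl.
(* Dropping the constant term of ['X * p] and the vanishing top term of [b * p] leaves both sums
   over d < N. *)
rewrite big_ord_recl coefXM mul0r add0r big_ord_recr /= pN mulr0 mul0r addr0.
rewrite -sumrB; apply: eq_bigr => d _.
rewrite hplethB1 coefXM /= /bump add1n -[d.+1]/(1 + d)%N PoszD addrA.
have -> : s + 1 + d%:Z - 1 = s + d%:Z by ring.
ring.
Qed.

End Series.

(** * The Newton basis and its evaluation determinant *)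

Section Newton.

Context (S : comNzRingType) (b : nat -> S).

Definition newton (k : nat) : {poly S} := \prod_(l < k) ('X - (b l)%:P).

Lemma size_newton k : size (newton k) = k.+1.
Proof. by rewrite size_prod_XsubC /index_enum -enumT size_enum_ord. Qed.

Lemma newton_coef k : (newton k)`_k = 1.
Proof.
have : lead_coef (newton k) = 1 by exact: lead_coef_prod_XsubC.
by rewrite /lead_coef size_newton.
Qed.

Lemma newton_coords (N : nat) (p : {poly S}) : (size p <= N)%N ->
  exists c : nat -> S, p = \sum_(k < N) c k *: newton k.
Proof.
elim: N p => [|N IH] p szp.
  by exists (fun=> 0); rewrite big_ord0; apply/eqP; rewrite -size_poly_leq0.
(* [newton N] is monic of degree N, so this subtraction kills the coefficient of degree N. *)
have [|c cP] := IH (p - p`_N *: newton N).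
  apply/leq_sizeP => j; rewrite leq_eqVlt => /predU1P[<-|ltNj].
    by rewrite coefB coefZ newton_coef mulr1 subrr.
  rewrite coefB coefZ (nth_default _ (leq_trans szp ltNj)).
  by rewrite [(newton N)`_j]nth_default ?size_newton // mulr0 subr0.
exists (fun k => if k == N then p`_N else c k).
rewrite big_ord_recr /= eqxx -[LHS](subrK (p`_N *: newton N)) {1}cP.
by congr (_ + _); apply: eq_bigr => k _; rewrite ltn_eqF.
Qed.

(** The change of basis from monomials is unitriangular, so the determinant is that of the ordinary
    Vandermonde matrix. *)
Lemma det_newton (n : nat) (x : 'I_n -> S) :
  \det (\matrix_(k < n, i < n) (newton k).[x i]) =
  \prod_(i < n) \prod_(j < n | (i < j)%N) (x j - x i).
Proof.
pose T : 'M[S]_n := \matrix_(k, d) (newton k)`_d.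
have -> : \matrix_(k < n, i < n) (newton k).[x i] =
          T *m Vandermonde n (\row_i x i).
  apply/matrixP => k i; rewrite !mxE (@horner_coef_wide _ n) ?size_newton //.
  by apply: eq_bigr => d _; rewrite !mxE.
have trigT : is_trig_mx T.
  apply/is_trig_mxP => k d ltkd.
  by rewrite mxE nth_default // size_newton.
rewrite det_mulmx det_trig // det_Vandermonde big1 ?mul1r => [|k _].
  by apply: eq_bigr => i _; apply: eq_bigr => j _; rewrite !mxE.
by rewrite mxE newton_coef.
Qed.

End Newton.

Lemma prod_offdiag (S : comNzRingType) (n : nat) (x : 'I_n -> S) :
  \prod_(j < n) \prod_(l < n | l != j) (x j - x l) =
  (\prod_(i < n) \prod_(j < n | (i < j)%N) (x i - x j)) *
  (\prod_(i < n) \prod_(j < n | (i < j)%N) (x j - x i)).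
Proof.
transitivity ((\prod_(j < n) \prod_(l < n | (j < l)%N) (x j - x l)) *
              (\prod_(j < n) \prod_(l < n | (l < j)%N) (x j - x l))).
  rewrite -big_split; apply: eq_bigr => j _ /=.
  rewrite (bigID (fun l : 'I_n => (j < l)%N)) /=.
  congr (_ * _); apply: eq_bigl => l; rewrite -val_eqE /=.
    by case: ltngtP.
  by case: ltngtP.
by congr (_ * _); rewrite (exchange_big_dep xpredT).
Qed.

(** * From Newton coordinates to the determinant identity *)

Section Transition.

Context (S : idomainType) (n : nat) (b : nat -> S) (x : 'I_n -> S).

Lemma prod_lt_neq0 : injective x ->
  \prod_(i < n) \prod_(j < n | (i < j)%N) (x i - x j) != 0.
Proof.
move=> x_inj; apply/prodf_neq0 => i _; apply/prodf_neq0 => j ltij.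
by rewrite subr_eq0 (inj_eq x_inj) -val_eqE /= ltn_eqF.
Qed.

(** The product of the transpose of [P] with the evaluation matrix [E] has entries prod_(l <> j)
    (x_i - x_l), zero off the diagonal. Its determinant is the product over all ordered pairs, from
    which the nonzero [\det E] cancels. *)
Lemma det_newton_coords (P : 'M[S]_n) : injective x ->
  (forall j, \prod_(l < n | l != j) ('X - (x l)%:P) =
             \sum_(k < n) P k j *: newton b k) ->
  \det P = \prod_(i < n) \prod_(j < n | (i < j)%N) (x i - x j).
Proof.
move=> x_inj defP.
pose E : 'M[S]_n := \matrix_(k, i) (newton b k).[x i].
have detE : \det E != 0.
  rewrite det_newton; apply/prodf_neq0 => i _; apply/prodf_neq0 => j ltij.
  by rewrite subr_eq0 (inj_eq x_inj) -val_eqE /= gtn_eqF.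
apply: (mulIf detE); rewrite {2}det_newton -prod_offdiag -det_tr -det_mulmx.
have PE j i : (P^T *m E) j i = \prod_(l < n | l != j) (x i - x l).
  rewrite mxE; transitivity ((\sum_(k < n) P k j *: newton b k).[x i]).
    by rewrite horner_sum; apply: eq_bigr => k _; rewrite !mxE hornerZ.
  by rewrite -defP horner_prod; apply: eq_bigr => l _; rewrite hornerXsubC.
rewrite det_trig; first by apply: eq_bigr => j _; rewrite PE.
apply/is_trig_mxP => j i ltji; rewrite PE (bigD1 i) /= ?subrr ?mul0r //.
by rewrite -val_eqE /= gtn_eqF.
Qed.

(** The shift [s i] and the alphabet [Y i] depend only on the row, the removed letters only on the
    column, so one matrix of Newton coordinates serves all rows. *)
Lemma det_hpleth_newton (Y : 'I_n -> {freeg S}) (s : 'I_n -> int) :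
  injective x ->
  \det (\matrix_(i < n, j < n)
    hpleth (s i + n.-1%:Z) (Y i - \sum_(l < n | l != j) << x l >>)) =
  \det (\matrix_(i < n, k < n)
    hpleth (s i + k%:Z) (Y i - \sum_(l < k) << b l >>)) *
  \prod_(i < n) \prod_(j < n | (i < j)%N) (x i - x j).
Proof.
move=> x_inj.
have szp (j : 'I_n) : size [seq x l | l <- index_enum 'I_n & l != j] = n.-1.
  transitivity #|predC1 j|; last by rewrite cardC1 card_ord.
  by rewrite size_map -sum1_size big_filter -sum1_card.
have defp (j : 'I_n) : \prod_(l < n | l != j) ('X - (x l)%:P) =
    \prod_(u <- [seq x l | l <- index_enum 'I_n & l != j]) ('X - u%:P).
  by rewrite big_map big_filter.
(* The index [j] is there only to force n > 0. *)
have ltn1 (j : 'I_n) : (n.-1 < n)%N by case: n j => [[]|].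
have [|c cP] := fin_all_exists (fun j : 'I_n =>
  @newton_coords S b n (\prod_(l < n | l != j) ('X - (x l)%:P)) _).
  by move=> j; rewrite defp size_prod_XsubC szp; exact: ltn1 j.
rewrite -(@det_newton_coords (\matrix_(k, j) c j k)) // => [|j]; last first.
  by rewrite cP; apply: eq_bigr => k _; rewrite mxE.
rewrite -det_mulmx; congr (\det _); apply/matrixP => i j; rewrite !mxE.
transitivity (\sum_(d < n)
    (\prod_(l < n | l != j) ('X - (x l)%:P))`_d * hpleth (s i + d%:Z) (Y i)).
  by rewrite defp hpleth_umbral szp ?(ltn1 j) // big_map big_filter.
rewrite cP; under eq_bigr => d _ do rewrite coef_sum mulr_suml.
rewrite exchange_big; apply: eq_bigr => k _; rewrite !mxE.
(* The same functional, now applied to each Newton polynomial of the expansion. *)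
have := @hpleth_umbral S [seq b l | l : 'I_k] (s i) (Y i) n.
rewrite size_map size_enum_ord => /(_ (ltn_ord k)); rewrite !big_image /= => <-.
rewrite mulrC mulr_sumr; apply: eq_bigr => d _.
by rewrite coefZ mulrA.
Qed.

End Transition.

Lemma mpolyXU_inj (R : nzRingType) (n : nat) :
  injective (fun i : 'I_n => 'X_i : {mpoly R[n]}).
Proof.
move=> i j /(congr1 (fun p => p@_U_(i))) /eqP.
rewrite !mcoeffX eqxx; have [|_] := eqVneq U_(j)%MM U_(i)%MM.
  by move=> /(congr1 (fun m : 'X_{1..n} => m i)); rewrite !mnm1E eqxx; case: eqP.
by rewrite oner_eq0.
Qed.

Theorem theorem5p1 (R : idomainType) (n : nat) (alpha beta : nat -> R)
    (lam : seq nat) (lam_part : is_partition lam) (lam_size : (size lam <= n)%N) :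
  g n alpha beta lam =
  (\det (\matrix_(i < n, j < n)
     hpleth (part lam i - i%:Z + j%:Z)
       (X R n - A n alpha (part lam i - 1) + B n beta i%:Z - B n beta j%:Z)))%:F.
Proof.
pose x (i : 'I_n) : {mpoly R[n]} := 'X_i.
(* Newton nodes are numbered from 0, the parameters beta from 1. *)
pose b l : {mpoly R[n]} := (beta l.+1)%:MP.
have BE (k : nat) : B n beta k%:Z = \sum_(l < k) << b l >>.
  by rewrite /B /alphabet big_add1 big_mkord.
pose Y (i : 'I_n) := X R n - A n alpha (part lam i - 1) + B n beta i%:Z.
have x_inj : injective x by exact: mpolyXU_inj.
have := @det_hpleth_newton _ n b x Y (fun i => part lam i - i%:Z) x_inj.
rewrite -/(vandermonde R n) => defN.
have bialtE : bialternant n alpha beta lam =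
  \det (\matrix_(i < n, j < n)
    hpleth (part lam i - i%:Z + j%:Z) (Y i - B n beta j%:Z)) * vandermonde R n.
  transitivity (\det (\matrix_(i < n, j < n)
    hpleth (part lam i - i%:Z + n.-1%:Z)
           (Y i - \sum_(l < n | l != j) << x l >>))).
    (* The letter x_j is X with all the other variables removed; for the degrees, the index [i]
       ensures that [n.-1] is n - 1. *)
    congr (\det _); apply/matrixP => i j; rewrite !mxE; congr hpleth.
      have -> : n%:Z = n.-1%:Z + 1.
        by rewrite -PoszD addn1 prednK // (leq_ltn_trans _ (ltn_ord i)).
      have -> : i.+1%:Z = i%:Z + 1 by rewrite -PoszD addn1.
      ring.
    rewrite /Y /X (bigD1 j) //= -/(x j); set s := \sum_(l < n | _) _.
    by rewrite 2!(addrAC _ s) addrK.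
  rewrite defN; congr (\det _ * _).
  by apply/matrixP => i j; rewrite !mxE BE.
rewrite /g bialtE rmorphM mulfK // tofrac_eq0.
exact: (@prod_lt_neq0 _ n x).
Qed.
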